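(* Let $n$ be a positive integer and let $K$ be a field of characteristic $p$ such that $0 < p \le n$. Then the algebra $\overline{R}_n$ of symmetric polynomials contains $Sym(\mathbb N)$-invariant ideals that are not finitely generated as $Sym(\mathbb N)$-invariant ideals of $\overline{R}_n$.
   Context: Let $\mathbb N = \{1,2,\dots\}$ and let $R_n = K[x_{ij} \mid 1\le i\le n,\ j\in\mathbb N]$ be the polynomial ring over $K$ in the variables $x_{ij}$. Let $S_n = Sym(\{1,2,\dots,n\})$ and $Sym(\mathbb N)$ be the groups of all permutations of $\{1,\dots,n\}$ and of $\mathbb N$, respectively. These groups act on $R_n$ by $K$-algebra automorphisms determined by $\tau(x_{ij}) = x_{\tau(i)j}$ for $\tau\in S_n$ and $\sigma(x_{ij}) = x_{i\sigma(j)}$ for $\sigma\in Sym(\mathbb N)$. Let $\overline{R}_n = \{ f\in R_n \mid \tau(f)=f \text{ for each } \tau\in S_n\}$ be the $K$-subalgebra of symmetric polynomials; it is stable under the action of $Sym(\mathbb N)$. An ideal $I$ of $\overline{R}_n$ is called $Sym(\mathbb N)$-invariant if $\sigma(I)=I$ for all $\sigma\in Sym(\mathbb N)$. The $Sym(\mathbb N)$-invariant ideal of $\overline{R}_n$ generated by a subset $A\subseteq\overline{R}_n$ is the smallest $Sym(\mathbb N)$-invariant ideal of $\overline{R}_n$ containing $A$, that is, the ideal of $\overline{R}_n$ generated by $\{\sigma(a)\mid a\in A,\ \sigma\in Sym(\mathbb N)\}$. A $Sym(\mathbb N)$-invariant ideal is finitely generated as a $Sym(\mathbb N)$-invariant ideal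 if it is generated in this sense by some finite set. *)

(* Defs.v *)
From HB Require Import structures.
From mathcomp Require Import all_boot all_order all_fingroup all_algebra.
From mathcomp Require Import finmap.
From mathcomp.multinomials Require Import monalg.
From mathcomp Require Import boolp classical_sets functions cardinality.

Set Implicit Arguments.
Unset Strict Implicit.
Unset Printing Implicit Defensive.

Import GRing.Theory.
Local Open Scope fset_scope.
Local Open Scope ring_scope.

(* Polynomials in an arbitrary, possibly infinite, family of variables indexed
   by I are {malg K[{cmonom I}]}; the variable indexed by v is << ucm v >>. *)
Section Rename.
Context (I : choiceType) (K : fieldType).
Implicit Types (s : I -> I) (m : {cmonom I}) (v : I).

Definition polyX v : {malg K[{cmonom I}]} := << (ucm v) >>.

Definition rename_monom s m : {malg K[{cmonom I}]} :=
  \prod_(v <- finsupp m) polyX (s v) ^+ m v.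

Lemma rename_monomEw s m (d : {fset I}) : finsupp m `<=` d ->
  rename_monom s m = \prod_(v <- d) polyX (s v) ^+ m v.
Proof.
move=> le; rewrite /rename_monom; apply/big_fset_incl => // v _.
by rewrite -cmE_eq0 => /eqP ->; rewrite expr0.
Qed.

Lemma rename_monom_mmorphism s : mmorphism (rename_monom s).
Proof.
split=> [m1 m2|]; last by rewrite /rename_monom mdom1 big_seq_fset0.
pose d := finsupp m1 `|` finsupp m2.
rewrite !(@rename_monomEw _ _ d) ?fsubsetUl ?fsubsetUr ?mdomD //.
by rewrite -big_split; apply: eq_bigr => v _; rewrite cmM exprD.
Qed.

HB.instance Definition _ s :=
  isMultiplicative.Build _ _ (rename_monom s) (rename_monom_mmorphism s).

(* The K-algebra endomorphism with x_v |-> x_(s v). *)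
Definition rename s : {malg K[{cmonom I}]} -> {malg K[{cmonom I}]} :=
  mmap (@malgC {cmonom I} K) (rename_monom s).

HB.instance Definition _ s := GRing.RMorphism.on (rename s).

Lemma rename_is_scalable s : scalable (rename s).
Proof. by move=> c f; rewrite /rename mmapZ mul_malgC. Qed.

HB.instance Definition _ s :=
  GRing.isScalable.Build K _ _ *:%R (rename s) (rename_is_scalable s).

Lemma renameX s v : rename s (polyX v) = polyX (s v).
Proof.
rewrite /rename /polyX mmapU [X in X * _](mpolyC1E _ K) mul1r /rename_monom mdomU.
by rewrite big_seq_fset1 cmUU expr1.
Qed.

Lemma polyX_prod m : << m >> = \prod_(v <- finsupp m) polyX v ^+ m v.
Proof.
have polyXM : {morph (fun k : {cmonom I} => << k >> : {malg K[{cmonom I}]})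
    : a b / mmul a b >-> a * b}.
  by move=> a b; rewrite malgM_def fgmulUU mulr1.
have polyX1 : << mone >> = 1 :> {malg K[{cmonom I}]} by [].
have polyXe v e : polyX v ^+ e = << iter e (mmul (ucm v)) mone >>.
  elim: e => [|e ih]; first by rewrite expr0 -polyX1.
  by rewrite exprS ih iterS polyXM.
under eq_bigr do rewrite polyXe.
rewrite -(big_morph _ polyXM polyX1); congr << _ >>.
apply/eqP/cmP => i.
have prodE (r : seq I) : uniq r ->
    (\big[mmul/mone]_(v <- r) iter (m v) (mmul (ucm v)) mone : {cmonom I}) i
    = if i \in r then m i else 0%N.
  elim: r => [|v r ih] /=; first by rewrite big_nil cm1.
  case/andP=> vr /ih{}ih; rewrite big_cons cmM ih in_cons.
  have -> : (iter (m v) (mmul (ucm v)) mone : {cmonom I}) i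
            = (m v * (v == i))%N.
    by elim: (m v) => [|e he]; rewrite ?cm1 // iterS cmM he cmU mulSn.
  rewrite eq_sym; have [->|_] := eqVneq i v; last by rewrite muln0.
  by rewrite (negPf vr) muln1 addn0.
rewrite prodE ?fset_uniq //.
by case: ifPn => //; rewrite -cmE_eq0 => /eqP.
Qed.

Lemma rename_uniq s (phi : {lrmorphism {malg K[{cmonom I}]} -> {malg K[{cmonom I}]}}) :
  (forall v, phi (polyX v) = polyX (s v)) -> phi =1 rename s.
Proof.
move=> phiX f; rewrite [f in LHS]monalgE raddf_sum /rename mmapE.
apply: eq_bigr => m _ /=.
have -> : << f@_m *g m >> = f@_m *: (<< m >> : {malg K[{cmonom I}]}).
  by apply/malgP => k; rewrite mcoeffU mcoeffZ mcoeffU1 mulr_natr.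
rewrite linearZ /= mul_malgC polyX_prod rmorph_prod; congr (_ *: _).
by apply: eq_bigr => v _; rewrite rmorphXn /= phiX.
Qed.

Lemma rename_comp s t f : rename s (rename t f) = rename (s \o t) f.
Proof.
have := @rename_uniq (s \o t) (rename s \o rename t : {lrmorphism _ -> _}).
by apply=> v; rewrite /= !renameX.
Qed.

End Rename.

(* The second index is shifted: j : nat stands for the index j + 1, and
   i : 'I_n for the index i + 1. *)
Notation "'R_[' n , K ]" := {malg K[{cmonom ('I_n * nat)%type}]}
  (at level 0, n at level 99, K at level 99, format "R_[ n ,  K ]")
  : type_scope.

Section SymmetricPolynomials.
Context (n : nat) (K : fieldType).

Definition rowact (t : 'S_n) : R_[n, K] -> R_[n, K] :=
  rename (fun v : 'I_n * nat => (t v.1, v.2)).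

Definition colact (s : nat -> nat) : R_[n, K] -> R_[n, K] :=
  rename (fun v : 'I_n * nat => (v.1, s v.2)).

HB.instance Definition _ t := GRing.LRMorphism.on (rowact t).
HB.instance Definition _ s := GRing.LRMorphism.on (colact s).

Definition sympoly : {pred R_[n, K]} :=
  fun f => [forall t : 'S_n, rowact t f == f].

Lemma sympolyP (f : R_[n, K]) :
  reflect (forall t, rowact t f = f) (f \in sympoly).
Proof. by apply: (iffP forallP) => h t; apply/eqP; apply: h. Qed.

Lemma sympoly_subalg_closed : subalg_closed sympoly.
Proof.
split=> [|c f g /sympolyP hf /sympolyP hg|f g /sympolyP hf /sympolyP hg].
- by apply/sympolyP => t; rewrite rmorph1.
- by apply/sympolyP => t; rewrite linearP /= hf hg.
- by apply/sympolyP => t; rewrite rmorphM /= hf hg.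
Qed.

HB.instance Definition _ :=
  GRing.isSubalgClosed.Build K R_[n, K] sympoly sympoly_subalg_closed.

Record symR : predArgType := SymR { symR_val :> R_[n, K]; _ : symR_val \in sympoly }.

HB.instance Definition _ := [isSub for symR_val].
HB.instance Definition _ := [Choice of symR by <:].
HB.instance Definition _ := [SubChoice_isSubComNzRing of symR by <:].
HB.instance Definition _ := [SubZmodule_isSubLmodule of symR by <:].
HB.instance Definition _ := [SubNzRing_SubLmodule_isSubLalgebra of symR by <:].
HB.instance Definition _ := [SubLalgebra_isSubAlgebra of symR by <:].

Lemma colact_sympoly s (f : R_[n, K]) : f \in sympoly -> colact s f \in sympoly.
Proof.
move=> /sympolyP hf; apply/sympolyP => t.
by rewrite -[in RHS](hf t) /rowact /colact !rename_comp.
Qed.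

Definition symact (s : nat -> nat) (f : symR) : symR :=
  SymR (colact_sympoly s (valP f)).

Lemma symact_comp s t f : symact (s \o t) f = symact s (symact t f).
Proof. by apply: val_inj; rewrite /= /colact rename_comp. Qed.

Lemma eq_symact s t : s =1 t -> symact s =1 symact t.
Proof. by move=> /funext ->. Qed.

Lemma symact_id f : symact id f = f.
Proof.
apply: val_inj; rewrite /= /colact; symmetry.
have := @rename_uniq _ K (fun v : 'I_n * nat => (v.1, id v.2))
  (idfun : {lrmorphism R_[n, K] -> R_[n, K]}).
by apply=> -[i j].
Qed.

Local Open Scope classical_set_scope.

Definition is_ideal (I : set symR) : Prop :=
  [/\ I 0, (forall f g, I f -> I g -> I (f + g)) &
      (forall a f, I f -> I (a * f))].

Definition sym_invariant_ideal (I : set symR) : Prop :=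
  is_ideal I /\ forall s : nat -> nat, bijective s -> symact s @` I = I.

Definition sym_generated (A : set symR) : set symR :=
  smallest sym_invariant_ideal A.

Lemma sym_generated_invariant_ideal (A : set symR) :
  sym_invariant_ideal (sym_generated A).
Proof.
have stable (s : nat -> nat) (f : symR) :
    bijective s -> sym_generated A f -> sym_generated A (symact s f).
  move=> sb Af J JA; case: (JA) => -[_ JS] _.
  by rewrite -(JS s sb); exists f => //; exact: Af.
split; first split.
- by move=> J [[[J0 _ _] _] _].
- move=> f g Af Ag J JA; case: (JA) => -[[_ JD _] _] _.
  by apply: JD; [exact: Af | exact: Ag].
- move=> a f Af J JA; case: (JA) => -[[_ _ JM] _] _.
  by apply: JM; exact: Af.
move=> s sb; apply/seteqP; split => [_ [f Af <-]|f Af]; first exact: stable.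
case: (sb) => t st ts.
exists (symact t f); first by apply: stable => //; exists s.
by rewrite -symact_comp -[RHS]symact_id; apply: eq_symact => j /=; rewrite ts.
Qed.

Definition sym_finitely_generated (I : set symR) : Prop :=
  exists2 A : set symR, finite_set A & I = sym_generated A.

End SymmetricPolynomials.

(* Main.v *)
Require Import Defs.
From mathcomp Require Import all_boot all_fingroup all_algebra.
From mathcomp Require Import finmap.
From mathcomp.multinomials Require Import monalg.
From mathcomp Require Import classical_sets cardinality.

Set Implicit Arguments.
Unset Strict Implicit.
Unset Printing Implicit Defensive.

(** For a finite set [B] of columns put
      [P_B = sum_i prod_(j in B) x_ij],
    a symmetric polynomial ([monpsum], [mpsum]). The ideal generated by all
    [P_B] with [B] finite and nonempty is the increasing union of the invariant
    ideals [I_N] generated by the [P_{0..k}] with [k < N], because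
    [Sym(nat)] acts on the [P_B] through its action on the finite sets [B]. If
    the union had a finite set of generators, all of them would lie in a single
    [I_N] ([bigcup_sym_finitely_generated]); so the point is that [P_{0..N}]
    does not belong to [I_N].

    To see this, take the additive functional [L] ([rooted_coef]) that sums the
    coefficients of the monomials [x_{c 0, 0} x_{c 1, 1} ... x_{c N, N}], where
    [c] ranges over the maps from the columns [0..N] to the first [p] rows that
    send column [0] to row [0]. Only the constant map [c = 0] contributes to
    [L (P_{0..N})], which is therefore [1] ([rooted_coef_mpsum]).

    On the other hand [L (P_B f) = 0] for [f] symmetric and [0 < |B| <= N]
    ([rooted_coef_mpsumM]). Indeed each monomial of [P_B f] has at least one
    variable in every column of [B], and those which survive in [L] have
    exactly one, so that this variable comes from [P_B]. Hence permuting the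
    rows inside the columns of [B] does not change the coefficients seen by [L]
    ([mcoeff_mpsumM_swap]), and neither does permuting them inside the other
    columns, since [P_B f] is symmetric ([mcoeff_mpsumM_swapC]). One of these
    two sets of columns avoids column [0] and meets [0..N] (or else [B] has a
    column beyond [N] and every coefficient is zero); moving a column of that
    set through the [p] rows splits [L (P_B f)] into [p] equal sums, and [p = 0]
    in [K] ([sum_swap_invariant]).

    The [f] such that [L (s f * g) = 0] for every permutation [s] and every
    symmetric [g] form an invariant ideal ([annihilator_sym_invariant]); it
    contains [I_N] but not [P_{0..N}].

    On symmetric polynomials, whose coefficient at such a monomial depends only
    on the partition of the columns [0..N] into the fibres of [c], the
    functional [L] weights each partition by the Moebius function
    [(-1)^(r-1) (r-1)!] of the partition lattice, [r] being the number of
    blocks: there are [(p-1) ... (p-r+1)] maps [c] inducing the partition. *)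

Import GRing.Theory.
Local Open Scope ring_scope.

(** * Coefficients of monomials *)

Section MonomialCoefficients.
Context (I : choiceType) (K : fieldType).
Implicit Types (m : {cmonom I}) (f g : {malg K[{cmonom I}]}).

Lemma cmonom_ind (P : {cmonom I} -> Prop) :
  P mone -> (forall v m, P m -> P (mmul (ucm v) m)) -> forall m, P m.
Proof.
move=> P1 PM m; move: {2}(mdeg m) (erefl (mdeg m)) => e.
elim: e m => [|e ih] m; first by move/mdeg_eq0I ->.
move=> me; have [m0|/fset0Pn[v vm]] := eqVneq (finsupp m) fset0.
  by move: me; rewrite mdegE m0 big_seq_fset0.
have mE : m = mmul (ucm v) (divcm m (ucm v)).
  apply/eqP/cmP => w; rewrite cmM divcmE cmU; have [<-|_] := eqVneq v w.
    by rewrite subnKC // lt0n cmE_neq0.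
  by rewrite add0n subn0.
rewrite mE; apply/PM/ih; move: me; rewrite {1}mE mdegM mdegU add1n.
by case.
Qed.

Lemma monomM m1 m2 :
  << mmul m1 m2 >> = << m1 >> * << m2 >> :> {malg K[{cmonom I}]}.
Proof. by rewrite malgM_def fgmulUU mulr1. Qed.

Lemma monomXM v m :
  << mmul (ucm v) m >> = Defs.polyX K v * << m >> :> {malg K[{cmonom I}]}.
Proof. exact: monomM. Qed.

Lemma monom_prod (J : Type) (r : seq J) (F : J -> {cmonom I}) :
  << \big[mmul/mone]_(j <- r) F j >>
  = \prod_(j <- r) << F j >> :> {malg K[{cmonom I}]}.
Proof. exact: (big_morph (fun m => << m >>) monomM). Qed.

Lemma monom_sum f : f = \sum_(m <- msupp f) f@_m *: << m >>.
Proof.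
rewrite {1}[f]monalgE; apply: eq_bigr => m _; apply/malgP => k.
by rewrite mcoeffU mcoeffZ mcoeffU1 mulr_natr.
Qed.

Lemma mcoeff_monomM_eq0 v m f (k : {cmonom I}) :
  (k v < m v)%N -> (<< m >> * f)@_k = 0.
Proof.
move=> kv; rewrite [f]monom_sum big_distrr raddf_sum big1 // => m' _ /=.
rewrite -scalerAr -monomM mcoeffZ mcoeffU1; case: eqP => [E|]; last first.
  by rewrite mulr0.
by move: kv; rewrite -E cmM ltnNge leq_addr.
Qed.

Lemma rename_monomP (s : I -> I) m : injective s ->
  exists2 m', rename s << m >> = << m' >> :> {malg K[{cmonom I}]}
            & forall v, m' (s v) = m v.
Proof.
move=> s_inj; elim/cmonom_ind: m => [|v m [m' sm m'E]].
  by exists mone => [|v]; [exact: rmorph1 | rewrite !cm1].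
exists (mmul (ucm (s v)) m') => [|w].
  by rewrite [in LHS]monomXM [RHS]monomXM rmorphM /= [X in X * _]renameX sm.
by rewrite !cmM m'E !cmU (inj_eq s_inj).
Qed.

Lemma mcoeff_rename (s : I -> I) f m m' : bijective s ->
  (forall v, m' (s v) = m v) -> (rename s f)@_m' = f@_m.
Proof.
move=> s_bij m'E; have s_inj := bij_inj s_bij; case: (s_bij) => t st ts.
rewrite [f]monom_sum (raddf_sum (rename s)) !raddf_sum.
apply: eq_bigr => k _ /=.
rewrite linearZ /= !mcoeffZ; have [k' -> k'E] := rename_monomP k s_inj.
rewrite !mcoeffU1; congr (_ * (_ : bool)%:R).
apply/cmP/cmP => [E v|E w]; first by rewrite -k'E E m'E.
by rewrite -[w]ts k'E E m'E.
Qed.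

End MonomialCoefficients.

(** * Power sums of squarefree monomials *)

Section PowerSums.
Context (n : nat) (K : fieldType).
Implicit Types (B : seq nat) (g : R_[n, K]).

Definition monpsum B : R_[n, K] :=
  \sum_(i < n) \prod_(j <- B) Defs.polyX K (i, j).

Lemma monpsum_sympoly B : monpsum B \in @sympoly n K.
Proof.
apply/sympolyP => t; rewrite /monpsum rmorph_sum /=.
rewrite [RHS](reindex_inj (@perm_inj _ t)); apply: eq_bigr => i _.
by rewrite /rowact rmorph_prod; apply: eq_bigr => j _ /=; rewrite renameX.
Qed.

Definition mpsum B : symR n K := SymR (monpsum_sympoly B).

Lemma symact_mpsum s B : symact s (mpsum B) = mpsum (map s B).
Proof.
apply: val_inj; rewrite /= /colact /monpsum rmorph_sum; apply: eq_bigr => i _.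
by rewrite /= big_map rmorph_prod; apply: eq_bigr => j _; rewrite /= renameX.
Qed.

(** Row permutation inside the columns of [B] only: unlike the action of the
    row permutations it is not the identity on symmetric polynomials, but it
    fixes [monpsum B]. *)
Definition rowmap B (t : 'S_n) (v : 'I_n * nat) : 'I_n * nat :=
  (if v.2 \in B then t v.1 else v.1, v.2).

Lemma rowmap_bij B t : bijective (rowmap B t).
Proof.
exists (rowmap B t^-1%g) => -[i j]; rewrite /rowmap /=.
  by case: (j \in B); rewrite ?permK.
by case: (j \in B); rewrite ?permKV.
Qed.

Lemma rename_rowmap_mpsum B t : rename (rowmap B t) (monpsum B) = monpsum B.
Proof.
rewrite /monpsum rmorph_sum [RHS](reindex_inj (@perm_inj _ t)).
apply: eq_bigr => i _; rewrite /= rmorph_prod.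
by apply: eq_big_seq => j jB; rewrite /= renameX /rowmap /= jB.
Qed.

Variable m : nat.
Implicit Type d : 'I_m -> 'I_n.

Definition colmon d : {cmonom ('I_n * nat)%type} :=
  \big[mmul/mone]_(j < m) ucm (d j, j : nat).

Lemma colmonE d v : colmon d v = (\sum_(j < m) (v == (d j, j : nat)))%N.
Proof.
rewrite /colmon (big_morph (fun k : {cmonom _} => k v) (cmM v) (cm1 v)).
by apply: eq_bigr => j _; rewrite cmU eq_sym.
Qed.

Lemma colmonE_in d i (j : 'I_m) : colmon d (i, j : nat) = (d j == i).
Proof.
rewrite colmonE (bigD1 j) //= big1 => [|k kj].
  by rewrite addn0 xpair_eqE eqxx andbT eq_sym.
have {}kj : (j : nat) != k by rewrite eq_sym.
by rewrite xpair_eqE (negPf kj) andbF.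
Qed.

Lemma colmonE_out d i (j : nat) : (m <= j)%N -> colmon d (i, j) = 0%N.
Proof.
move=> mj; rewrite colmonE big1 // => k _; rewrite xpair_eqE.
by rewrite [j == _]gtn_eqF ?andbF // (leq_trans (ltn_ord k)).
Qed.

Lemma mcoeff_colmon_rename s d d' g : bijective s ->
    (forall j : 'I_m, s (d j, j : nat) = (d' j, j : nat)) ->
  (rename s g)@_(colmon d') = g@_(colmon d).
Proof.
move=> s_bij sd; apply: mcoeff_rename => // v; rewrite !colmonE.
by apply: eq_bigr => j _; rewrite -sd (inj_eq (bij_inj s_bij)).
Qed.

Lemma mcoeff_colmon_sym (f : symR n K) (t : 'S_n) d :
  (f : R_[n, K])@_(colmon (t \o d)) = (f : R_[n, K])@_(colmon d).
Proof.
have /sympolyP/(_ t) {1}<- := valP f.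
apply: mcoeff_colmon_rename => //.
by exists (fun v => ((t^-1)%g v.1, v.2)) => -[i j]; rewrite /= ?permK ?permKV.
Qed.

(** [colmon d] has at most one variable in each column. *)
Lemma mcoeff_two_in_col (i i' : 'I_n) (b : nat) d g :
  (Defs.polyX K (i, b) * Defs.polyX K (i', b) * g)@_(colmon d) = 0.
Proof.
rewrite /polyX -monomM; have [mb|bm] := leqP m b.
  by apply: (@mcoeff_monomM_eq0 _ _ (i, b)); rewrite colmonE_out // cmM cmUU.
(* In row [w] the two factors have a larger exponent than [colmon d]: [1] against
   [0] if [i != i'], and [2] against at most [1] otherwise. *)
set j := Ordinal bm; pose w := if d j == i then i' else i.
apply: (@mcoeff_monomM_eq0 _ _ (w, b)).
rewrite cmM !cmU -[b]/(nat_of_ord j) colmonE_in !xpair_eqE eqxx !andbT /w.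
have [dji|dji] := eqVneq (d j) i; last by rewrite (negPf dji) eqxx.
by rewrite dji eqxx addn1.
Qed.

(** Every term of [monpsum B] already has a variable in column [b]; a second one
    takes the product out of reach of the monomials [colmon d]. *)
Lemma mcoeff_X_mpsum B (i : 'I_n) (b : nat) d g : b \in B ->
  (monpsum B * (Defs.polyX K (i, b) * g))@_(colmon d) = 0.
Proof.
move=> bB; rewrite /monpsum big_distrl raddf_sum big1 // => i' _ /=.
rewrite (perm_big _ (perm_to_rem bB)) big_cons.
by rewrite mulrACA mcoeff_two_in_col.
Qed.

(** The dichotomy behind [mcoeff_mpsumM_rename]: a monomial that the row map
    can move involves a column of [B], hence contributes nothing after
    multiplication by [monpsum B]. *)
Lemma rename_rowmap_monom B t (k : {cmonom ('I_n * nat)%type}) :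
  rename (rowmap B t) << k >> = << k >> :> R_[n, K] \/
  exists v k', v.2 \in B /\ << k >> = Defs.polyX K v * << k' >>.
Proof.
elim/cmonom_ind: k => [|v k ih]; first by left; exact: rmorph1.
case: (boolP (v.2 \in B)) => vB; first by right; exists v, k; rewrite monomXM.
rewrite monomXM; case: ih => [E|[w [k' [wB E]]]]; last first.
  right; exists w, (mmul (ucm v) k'); split; first exact: wB.
  by rewrite [in RHS]monomXM [RHS]mulrCA; congr (_ * _); exact: E.
left; rewrite rmorphM [X in _ * X = _]E [X in X * _ = _]renameX.
by rewrite /rowmap (negPf vB) -surjective_pairing.
Qed.

Lemma mcoeff_mpsumM_rename B t d g :
  (rename (rowmap B t) (monpsum B * g))@_(colmon d)
  = (monpsum B * g)@_(colmon d).
Proof.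
rewrite rmorphM /= rename_rowmap_mpsum.
have monom_case (k : {cmonom ('I_n * nat)%type}) :
    (monpsum B * rename (rowmap B t) << k >>)@_(colmon d)
    = (monpsum B * << k >>)@_(colmon d).
  have [E|[[i b] [k' [bB E]]]] := rename_rowmap_monom B t k.
    by rewrite [X in _ * X]E.
  rewrite E [RHS]mcoeff_X_mpsum // rmorphM /= [X in _ * (X * _)]renameX.
  by rewrite mcoeff_X_mpsum.
rewrite [g]monom_sum (raddf_sum (rename (rowmap B t))) /=.
rewrite mulr_sumr [in RHS]mulr_sumr.
rewrite [LHS](raddf_sum (mcoeff (colmon d))).
rewrite [RHS](raddf_sum (mcoeff (colmon d))).
apply: eq_bigr => k _ /=; rewrite [rename _ _]linearZ /=.
rewrite -[in LHS]scalerAr -[in RHS]scalerAr [LHS]mcoeffZ [RHS]mcoeffZ.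
exact: (congr1 ( *%R g@_k) (monom_case k)).
Qed.

Lemma mcoeff_mpsumM_swap B (t : 'S_n) d d' g :
    (forall j : 'I_m, d' j = if (j : nat) \in B then t (d j) else d j) ->
  (monpsum B * g)@_(colmon d') = (monpsum B * g)@_(colmon d).
Proof.
move=> d'E; rewrite -(mcoeff_mpsumM_rename B t).
apply: mcoeff_colmon_rename; first exact: rowmap_bij.
by move=> j; rewrite /rowmap d'E.
Qed.

(** Permuting the rows in all columns does not change the coefficients of the
    symmetric polynomial [monpsum B * f], and neither does permuting them in the
    columns of [B]; permuting them outside [B] is the quotient of the two. *)
Lemma mcoeff_mpsumM_swapC B (t : 'S_n) d d' (f : symR n K) :
    (forall j : 'I_m, d' j = if (j : nat) \in B then d j else t (d j)) ->
  (monpsum B * symR_val f)@_(colmon d') = (monpsum B * symR_val f)@_(colmon d).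
Proof.
move=> d'E; rewrite -(mcoeff_colmon_sym (mpsum B * f) t d) /=.
symmetry; apply: (mcoeff_mpsumM_swap (t := t)) => j /=.
by rewrite d'E; case: (_ \in B).
Qed.

Lemma mcoeff_mpsumM_out B b d g : b \in B -> (m <= b)%N ->
  (monpsum B * g)@_(colmon d) = 0.
Proof.
move=> bB mb; rewrite /monpsum mulr_suml (raddf_sum (mcoeff (colmon d))).
rewrite big1 // => i _ /=; rewrite (perm_big _ (perm_to_rem bB)) big_cons.
rewrite -mulrA; apply: (@mcoeff_monomM_eq0 _ _ (i, b)).
by rewrite cmUU colmonE_out.
Qed.

End PowerSums.

(** * Sums over maps with one fixed value *)

Section RootedSum.
Variables (K : fieldType) (N q : nat).
Hypothesis q0 : q.+1%:R = 0 :> K.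

Definition swap_on (D : pred 'I_N) (k : 'I_q.+1)
    (c : {ffun 'I_N -> 'I_q.+1}) : {ffun 'I_N -> 'I_q.+1} :=
  [ffun j => if D j then tperm ord0 k (c j) else c j].

Lemma swap_onK D k : involutive (swap_on D k).
Proof.
by move=> c; apply/ffunP => j; rewrite !ffunE; case: (D j); rewrite ?tpermK.
Qed.

(** Split the sum according to the value [k] of [c b]: the transposition of [0]
    and [k] on [D] matches the part of [k] with the part of [0], without moving
    [c a]. There are [q + 1 = 0] equal parts. *)
Lemma sum_swap_invariant (D : pred 'I_N) (a b : 'I_N)
    (F : {ffun 'I_N -> 'I_q.+1} -> K) :
    ~~ D a -> D b -> (forall k c, F (swap_on D k c) = F c) ->
  \sum_(c : {ffun 'I_N -> 'I_q.+1} | c a == ord0) F c = 0.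
Proof.
move=> Da Db Fswap.
rewrite (partition_big (fun c : {ffun _} => c b) predT) //=.
rewrite (eq_bigr (fun=> \sum_(c : {ffun 'I_N -> 'I_q.+1}
    | (c a == ord0) && (c b == ord0)) F c)).
  by rewrite sumr_const card_ord -mulr_natr q0 mulr0.
move=> k _; rewrite (reindex_inj (inv_inj (swap_onK D k))) /=.
apply: eq_big => [c|c _]; last exact: Fswap.
rewrite !ffunE (negPf Da) Db; congr (_ && _).
by rewrite -{2}(tpermL ord0 k) (inj_eq perm_inj).
Qed.

End RootedSum.

(** * The functional separating the ideals *)

Section RootedCoefficients.
Variables (n : nat) (K : fieldType) (N q : nat).
Hypotheses (qn : (q < n)%N) (q0 : q.+1%:R = 0 :> K).
Implicit Type g : R_[n, K].

Local Notation rows c := (widen_ord qn \o (c : {ffun 'I_N.+1 -> 'I_q.+1})).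

(** Only the first [q.+1] rows occur, [q.+1] being the characteristic. Fixing
    [c ord0] keeps the functional from vanishing on all power sums: summing over
    all [c], [monpsum] of the columns [0..N] would have the value
    [q.+1%:R = 0]. *)
Definition rooted_coef g : K :=
  \sum_(c : {ffun 'I_N.+1 -> 'I_q.+1} | c ord0 == ord0) g@_(colmon (rows c)).

Lemma rooted_coefD : {morph rooted_coef : f g / f + g}.
Proof.
by move=> f g; rewrite -big_split; apply: eq_bigr => c _; rewrite mcoeffD.
Qed.

Lemma rows_swap D k c j : rows (swap_on D k c) j =
  if D j then tperm (widen_ord qn ord0) (widen_ord qn k) (rows c j)
  else rows c j.
Proof.
rewrite /= ffunE; case: (D j) => //.
by apply: inj_tperm => x y /(congr1 val) xy; apply: val_inj.
Qed.

(** When column [0] lies in [B], a column of [0..N] outside [B] exists because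
    [B] has at most [N] elements, and the columns outside [B] are permuted.
    Otherwise the columns of [B] themselves are permuted. *)
Lemma rooted_coef_mpsumM B (f : symR n K) :
    uniq B -> (0 < size B <= N)%N ->
  rooted_coef (monpsum n K B * symR_val f) = 0.
Proof.
move=> uB /andP[B0 BN].
have [/hasP[b bB mb]|/hasPn Bm] := boolP (has (fun b => N < b)%N B).
  by rewrite /rooted_coef big1 // => c _; rewrite (mcoeff_mpsumM_out _ _ bB).
have [B0in|B0notin] := boolP (0%N \in B).
  have [b bB] : exists b : 'I_N.+1, (b : nat) \notin B.
    apply/existsP; apply: contraT; rewrite negb_exists => /forallP sB.
    have: (size (iota 0 N.+1) <= size B)%N.
      apply: uniq_leq_size; first exact: iota_uniq.
      move=> j; rewrite mem_iota /= add0n => jN.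
      by have := sB (Ordinal jN); rewrite negbK.
    by rewrite size_iota ltnNge BN.
  apply: (sum_swap_invariant q0 (D := [pred j : 'I_N.+1 | (j : nat) \notin B])
    (b := b)) => //=; first by rewrite negbK.
  move=> k c; apply: mcoeff_mpsumM_swapC => j; rewrite rows_swap /=.
  by case: (_ \in B).
case: B B0 {BN uB} Bm B0notin => // b B _ Bm B0notin.
have bN : (b < N.+1)%N by rewrite ltnS leqNgt Bm ?mem_head.
apply: (sum_swap_invariant q0
  (D := [pred j : 'I_N.+1 | (j : nat) \in b :: B]) (b := Ordinal bN)) => //=.
  exact: mem_head.
by move=> k c; apply: mcoeff_mpsumM_swap => j; rewrite rows_swap.
Qed.

(** The coefficient at a map [c] is [1] if [c] is constant and [0] otherwise. *)
Lemma rooted_coef_mpsum : rooted_coef (monpsum n K (iota 0 N.+1)) = 1.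
Proof.
have monE : monpsum n K (iota 0 N.+1)
    = \sum_(i < n) << colmon (fun _ : 'I_N.+1 => i) >>.
  apply: eq_bigr => i _; rewrite /colmon monom_prod.
  by rewrite -[iota 0 _]/(index_iota 0 N.+1) big_mkord.
rewrite /rooted_coef (bigD1 [ffun=> ord0]) /= ?ffunE //.
have coefE c : (monpsum n K (iota 0 N.+1))@_(colmon (rows c))
    = ([forall j, c j == c ord0])%:R.
  rewrite monE (raddf_sum (mcoeff (colmon (rows c)))) /=.
  rewrite (eq_bigr (fun i : 'I_n =>
    (colmon (fun _ : 'I_N.+1 => i) == colmon (rows c))%:R)); last first.
    by move=> i _; exact: mcoeffU1.
  rewrite (bigD1 (rows c ord0)) //= big1 => [|i ic]; last first.
    case: eqP => //.
    move=> /(congr1 (fun k : {cmonom _} => k (i, 0%N))).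
    rewrite -[0%N]/(nat_of_ord (ord0 : 'I_N.+1)) !colmonE_in eqxx.
    by rewrite eq_sym (negPf ic).
  rewrite addr0; congr (_ : bool)%:R; apply/eqP/forallP => [E j|E].
    have /(congr1 (fun k : {cmonom _} => k (rows c ord0, j : nat))) := E.
    rewrite !colmonE_in eqxx /=; case: eqP => // /(congr1 val) /= cj _.
    by apply/eqP/val_inj.
  rewrite /colmon; apply: eq_bigr => j _; congr (ucm (_, _)).
  by rewrite /= (eqP (E j)).
rewrite coefE big1 => [|c /andP[/eqP c0 cn0]].
  rewrite addr0; case: forallP => // -[]; move=> j; by rewrite !ffunE.
rewrite coefE; case: forallP => // cE; case/eqP: cn0.
by apply/ffunP => j; rewrite ffunE (eqP (cE j)) c0.
Qed.

End RootedCoefficients.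

(** * Invariant ideals and their increasing unions *)

Section InvariantIdeals.
Variables (n : nat) (K : fieldType).
Implicit Types (f g : symR n K).
Local Open Scope classical_set_scope.

Lemma symactD s : {morph @symact n K s : f g / f + g}.
Proof. by move=> f g; apply: val_inj; rewrite /= rmorphD. Qed.

Lemma symactM s : {morph @symact n K s : f g / f * g}.
Proof. by move=> f g; apply: val_inj; rewrite /= rmorphM. Qed.

Lemma symact0 s : symact s (0 : symR n K) = 0.
Proof. by apply: val_inj; rewrite /= rmorph0. Qed.

(** One inclusion suffices, since it can be applied to the inverse permutation
    too. *)
Lemma sym_invariant_idealP (J : set (symR n K)) : is_ideal J ->
    (forall s f, bijective s -> J f -> J (symact s f)) ->
  sym_invariant_ideal J.
Proof.
move=> Jid Js; split=> // s s_bij; apply/seteqP; split=> [_ [f Jf <-]|f Jf].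
  exact: Js.
case: (s_bij) => t st ts; exists (symact t f).
  by apply: Js => //; exists s.
by rewrite -symact_comp (eq_symact (t := id) ts) symact_id.
Qed.

Lemma sym_invariant_ideal_act (J : set (symR n K)) s f :
  sym_invariant_ideal J -> bijective s -> J f -> J (symact s f).
Proof. by move=> [_ Js] s_bij Jf; rewrite -(Js s s_bij); exists f. Qed.

(** Testing against all translates makes the kernel invariant, and against all
    multiples makes it an ideal, whatever the additive functional. *)
Lemma annihilator_sym_invariant (L : symR n K -> K) :
    {morph L : f g / f + g} ->
  sym_invariant_ideal
    [set f | forall s g, bijective s -> L (symact s f * g) = 0].
Proof.
move=> LD; have L0 : L 0 = 0.
  by apply: (addrI (L 0)); rewrite -LD !addr0.
apply: sym_invariant_idealP => /=; first split=> [s g _|f g Jf Jg s h sb|].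
- by rewrite symact0 mul0r.
- by rewrite symactD mulrDl LD Jf // Jg // addr0.
- by move=> a f Jf s g sb; rewrite symactM -mulrA mulrCA Jf.
- by move=> s f sb Jf t g tb; rewrite -symact_comp Jf //; exact: bij_comp.
Qed.

Variable J : nat -> set (symR n K).
Hypotheses (J_ideal : forall N, sym_invariant_ideal (J N))
  (J_mono : forall M N, (M <= N)%N -> J M `<=` J N).

Lemma bigcup_sym_invariant : sym_invariant_ideal (\bigcup_N J N).
Proof.
apply: sym_invariant_idealP; first split.
- by exists 0%N => //; case: (J_ideal 0) => -[].
- move=> f g [M _ Jf] [N _ Jg]; exists (maxn M N) => //.
  case: (J_ideal (maxn M N)) => -[_ JD _] _.
  by apply: JD; [apply: J_mono Jf; exact: leq_maxl
                |apply: J_mono Jg; exact: leq_maxr].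
- move=> a f [N _ Jf]; exists N => //.
  by case: (J_ideal N) => -[_ _ JM] _; exact: JM.
- by move=> s f sb [N _ Jf]; exists N => //; exact: sym_invariant_ideal_act.
Qed.

(** A finite set of generators lies in one term of the chain. *)
Lemma bigcup_sym_finitely_generated :
  sym_finitely_generated (\bigcup_N J N) -> exists N, \bigcup_N J N `<=` J N.
Proof.
move=> [A /finite_seqP[r ->] genA].
have sub_gen : [set` r] `<=` \bigcup_N J N by rewrite genA; exact: sub_smallest.
suff [N rN] : exists N, [set` r] `<=` J N.
  by exists N; rewrite genA; exact: smallest_sub.
elim: r {genA} sub_gen => [|f r ih] sub; first by exists 0%N.
have [|N rN] := ih; first by move=> g gr; apply: sub; rewrite /= inE gr orbT.
have [|M _ fM] := sub f; first by rewrite /= mem_head.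
exists (maxn M N) => g /=; rewrite inE => /orP[/eqP->|/rN].
  by apply: J_mono fM; exact: leq_maxl.
by apply: J_mono; exact: leq_maxr.
Qed.

End InvariantIdeals.

(** * The chain of ideals generated by power sums *)

Section Chain.
Variables (n : nat) (K : fieldType).
Local Open Scope classical_set_scope.

Definition mpsum_ideal (N : nat) : set (symR n K) :=
  sym_generated [set mpsum n K (iota 0 k.+1) | k in [set k | (k < N)%N]].

Lemma mpsum_ideal_mono M N : (M <= N)%N -> mpsum_ideal M `<=` mpsum_ideal N.
Proof.
move=> MN; apply: smallest_sub; first exact: sym_generated_invariant_ideal.
move=> _ [k kM <-]; apply: sub_gen_smallest; exists k => //=.
exact: leq_trans MN.
Qed.

Lemma mpsum_in_ideal N : mpsum_ideal N.+1 (mpsum n K (iota 0 N.+1)).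
Proof. by apply: sub_gen_smallest; exists N => //=. Qed.

Lemma mpsum_notin_ideal (q N : nat) : (q < n)%N -> q.+1%:R = 0 :> K ->
  ~ mpsum_ideal N (mpsum n K (iota 0 N.+1)).
Proof.
move=> qn q0.
pose L (f : symR n K) := rooted_coef N qn (symR_val f).
have LD : {morph L : f g / f + g} by move=> f g; exact: rooted_coefD.
have sub : mpsum_ideal N
    `<=` [set f | forall s g, bijective s -> L (symact s f * g) = 0].
  apply: smallest_sub; first exact: annihilator_sym_invariant.
  move=> _ [k kN <-] s g sb; rewrite symact_mpsum.
  apply: (rooted_coef_mpsumM qn q0); last by rewrite size_map size_iota.
  by rewrite map_inj_uniq ?iota_uniq //; exact: bij_inj.
move=> /sub /(_ id 1); rewrite symact_id mulr1 /L /= rooted_coef_mpsum.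
by move=> /(_ (inv_bij (fun=> erefl))) /eqP; rewrite oner_eq0.
Qed.

End Chain.

Theorem theorem5 (n : nat) (hn : (0 < n)%N) (K : fieldType) (p : nat)
    (hK : p \in [pchar K]%R) (hp : (0 < p <= n)%N) :
  exists I : set (symR n K),
    sym_invariant_ideal I /\ ~ sym_finitely_generated I.
Proof.
case: p hK hp => // q /pcharf0 q0 /= qn.
exists (\bigcup_N mpsum_ideal N)%classic; split.
  apply: bigcup_sym_invariant; last exact: mpsum_ideal_mono.
  by move=> N; exact: sym_generated_invariant_ideal.
move=> /bigcup_sym_finitely_generated[||N sub].
- by move=> N; exact: sym_generated_invariant_ideal.
- exact: mpsum_ideal_mono.
apply: (mpsum_notin_ideal qn q0 (N := N)); apply: sub.
by exists N.+1 => //; exact: mpsum_in_ideal.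
Qed.
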